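(* Let $\mu_k:=\frac{B_{k+1}}{k+1}$ for $k\ge0$, where $B_k$ are the Bernoulli numbers. Then for all $n=0,1,2,\ldots$, $$H_n(\mu_{k+1})=\det\left(\mu_{i+j+1}\right)_{0\le i,j\le n}\neq 0.$$
   Context: The Bernoulli numbers $B_k$ are defined by $\frac{t}{e^t-1}=\sum_{k\ge0}B_k\frac{t^k}{k!}$ (so $B_1=-1/2$). For a sequence $(c_k)_{k\ge0}$, $H_n(c_k):=\det(c_{i+j})_{0\le i,j\le n}$; $H_n(\mu_{k+1})$ is the Hankel determinant of the shifted sequence $(\mu_{k+1})_{k\ge0}$. *)

(* Defs.v *)
From mathcomp Require Import all_boot all_order all_algebra.

Set Implicit Arguments.
Unset Strict Implicit.
Unset Printing Implicit Defensive.

Import GRing.Theory Num.Theory.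
Local Open Scope ring_scope.

(* A formal power series over the rationals is its sequence of coefficients:
   f stands for \sum_k f k * t ^ k. *)
Definition fps := nat -> rat.

Definition fpsM (f g : fps) : fps :=
  fun n => \sum_(i < n.+1) f i * g (n - i)%N.

Definition fpsB (f g : fps) : fps := fun n => f n - g n.

Definition fps1 : fps := fun n => (n == 0)%N%:R.

Definition fpsX : fps := fun n => (n == 1)%N%:R.

(* \sum_k c k * t ^ k / k!, which is e ^ t when c = 1. *)
Definition egf (c : nat -> rat) : fps := fun k => c k / (k`!)%:R.

Definition fps_exp : fps := egf (fun=> 1).

(* t / (e ^ t - 1) = \sum_k B k * t ^ k / k!.  The constant coefficient of
   e ^ t - 1 vanishes, so this series has no inverse; as Q[[t]] is an integral
   domain, the quotient is the only series F with (e ^ t - 1) * F = t. *)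
Definition is_bernoulli (B : nat -> rat) : Prop :=
  forall n, fpsM (fpsB fps_exp fps1) (egf B) n = fpsX n.

Definition mu (B : nat -> rat) (k : nat) : rat := B k.+1 / (k.+1)%:R.

(* The matrix has size n + 1, with indices 0, ..., n. *)
Definition hankel_det (n : nat) (c : nat -> rat) : rat :=
  \det (\matrix_(i < n.+1, j < n.+1) c (i + j)%N).

(* The generating function determines exactly one sequence: existence and
   uniqueness below, so that a hypothesis [is_bernoulli B] is never vacuous. *)

Lemma is_bernoulliE (B : nat -> rat) :
  is_bernoulli B <->
  forall n, egf B n =
    (n == 0)%N%:R - \sum_(i < n) egf B i / (((n - i).+1)`!)%:R.
Proof.
have E n : fpsM (fpsB fps_exp fps1) (egf B) n.+1 =
    \sum_(i < n) egf B i / (((n - i).+1)`!)%:R + egf B n.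
  rewrite /fpsM big_ord_recl /fpsB /fps_exp /fps1 /= {1}/egf divr1 subrr mul0r.
  rewrite add0r (reindex_inj rev_ord_inj) big_ord_recr /=; congr (_ + _).
    apply: eq_bigr => i _; rewrite /bump /= add1n subr0 mulrC {2}/egf mul1r.
    by rewrite !subSS subKn // ltnW.
  by rewrite /bump /= subnn addn0 subSS subn0 {1}/egf subr0 divr1 mul1r.
split=> [H n|H [|n]].
- by have := H n.+1; rewrite E /fpsX eqSS => <-; rewrite addrC addKr.
- by rewrite /fpsM big_ord1 /fpsB /fps_exp /fps1 {1}/egf divr1 subrr mul0r.
- by rewrite E [egf B n]H addrC subrK /fpsX eqSS.
Qed.

Lemma is_bernoulli_uniq (B C : nat -> rat) :
  is_bernoulli B -> is_bernoulli C -> B =1 C.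
Proof.
move=> /is_bernoulliE HB /is_bernoulliE HC n.
have E : egf B n = egf C n.
  elim/ltn_ind: n => m IH; rewrite HB HC; congr (_ - _).
  by apply: eq_bigr => i _; rewrite IH.
have n0 : (n`!)%:R != 0 :> rat by rewrite pnatr_eq0 -lt0n fact_gt0.
by move/(congr1 (fun x => x * (n`!)%:R)): E; rewrite /egf !divfK.
Qed.

Lemma is_bernoulli_ex : exists B : nat -> rat, is_bernoulli B.
Proof.
pose next (s : seq rat) : rat := (size s == 0)%N%:R -
  \sum_(i < size s) s`_i / (((size s - i).+1)`!)%:R.
pose s n := iter n (fun s => rcons s (next s)) [::].
have ss n : size (s n) = n by elim: n => //= n IH; rewrite size_rcons IH.
have sP m n : (m < n)%N -> (s n)`_m = next (s m).
  elim: n => // n IH; rewrite ltnS leq_eqVlt => /predU1P[->|mn].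
    by rewrite /= nth_rcons ss ltnn eqxx.
  by rewrite /= nth_rcons ss mn IH.
exists (fun n => next (s n) * (n`!)%:R); apply/is_bernoulliE => n.
have E m : egf (fun n => next (s n) * (n`!)%:R) m = next (s m).
  by rewrite /egf mulfK // pnatr_eq0 -lt0n fact_gt0.
rewrite E {1}/next ss; congr (_ - _).
by apply: eq_bigr => i _; rewrite E sP.
Qed.

Lemma is_bernoulli_small (B : nat -> rat) :
  is_bernoulli B -> [/\ B 0%N = 1, B 1%N = - 2^-1 & B 2%N = 6^-1].
Proof.
move=> /is_bernoulliE H.
have e0 : egf B 0 = 1 by rewrite H big_ord0.
have e1 : egf B 1 = - 2^-1.
  by rewrite H big_ord_recl big_ord0 e0.
have e2 : egf B 2 = 12^-1.
  by rewrite H !big_ord_recl big_ord0 /= e0 /bump /= e1.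
split.
- by rewrite -e0 /egf divr1.
- by rewrite -e1 /egf divr1.
- by have := congr1 (fun x => x * 2) e2; rewrite /egf divfK // => ->.
Qed.

(* Main.v *)
(* Put beta(t) = t / (e^t - 1) = \sum_k B_k t^k / k!.  The series
   N_l = beta * \sum_k tau l k t^k is the quotient i_l(t/2) / i_0(t/2) of
   modified spherical Bessel functions.  The three-term recurrence in l (the
   Lambert continued fraction of coth) telescopes to
     B_(i+j+2) / (i+j+2)! =
       \sum_l (-1)^l (2l+3) [t^(i+1)]N_(l+1) [t^(j+1)]N_(l+1).
   Since [t^(i+1)]N_(l+1) = 0 unless i = l mod 2, the sign (-1)^l can be
   replaced by (-1)^i, so multiplying row i of this Hankel matrix by (-1)^i
   makes it positive definite.  The matrix ((-1)^i mu_(i+j+1)) is the Hadamard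
   product of the result with ((i+j+1)!), which is a sum of positive rank-one
   matrices; as in Schur's product theorem, it is again positive definite. *)
Require Import Defs.
From mathcomp Require Import all_boot all_order all_algebra.
From mathcomp Require Import ring zify.
Set Implicit Arguments.
Unset Strict Implicit.
Unset Printing Implicit Defensive.
Import GRing.Theory Num.Theory.
Local Open Scope ring_scope.

(** \sum_k [tau l k] t^k is e^(t/2) i_l(t/2), which for l = 0 is (e^t - 1) / t. *)
Definition tau (l k : nat) : rat := (k ^_ l)%:R / ((k + l).+1`!)%:R.

Lemma fact_neq0 (k : nat) : (k`!)%:R != 0 :> rat.
Proof. by rewrite pnatr_eq0 -lt0n fact_gt0. Qed.

Lemma natr_factS (k : nat) : (k.+1`!)%:R = (k.+1)%:R * (k`!)%:R :> rat.
Proof. by rewrite factS natrM. Qed.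

Lemma tau_small (l k : nat) : (k < l)%N -> tau l k = 0.
Proof. by move=> lt_kl; rewrite /tau ffact_small // mul0r. Qed.

(** The Bessel recurrence i_l(x) - i_(l+2)(x) = (2l+3) i_(l+1)(x) / x at x = t/2. Over the common
    denominator (k+l+3)! it becomes [E]. *)
Lemma tau_rec (l k : nat) :
  tau l k = 2 * (2 * l + 3)%:R * tau l.+1 k.+1 + tau l.+2 k.
Proof.
have E : (k ^_ l * ((k + l).+2 * (k + l).+3) =
    2 * (2 * l + 3) * k.+1 ^_ l.+1 + k ^_ l.+2)%N.
  rewrite ffactSS !ffactnSr; have [lt_kl|] := ltnP k l.
    by rewrite !ffact_small // !(mul0n, muln0).
  by move: (k ^_ l)%N => x /subnKC <-; move: (k - l)%N => [|d]; nia.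
rewrite /tau addSnnS !(addnS k).
rewrite mulrA -mulrDl -[2]/(2%:R) -!natrM -natrD -E.
rewrite (natr_factS (k + l).+2) (natr_factS (k + l).+1).
move: ((k + l).+1)`! (fact_gt0 (k + l).+1) => f f0.
by field; rewrite -!natrD ?nat1r !pnatr_eq0 -lt0n f0.
Qed.

(** This is [t^k]N_l. *)
Definition bern_tau (B : nat -> rat) (l k : nat) : rat :=
  \sum_(i < k.+1) egf B i * tau l (k - i).

Lemma bern_tau_rec (B : nat -> rat) (l k : nat) :
  bern_tau B l k =
    2 * (2 * l + 3)%:R * bern_tau B l.+1 k.+1 + bern_tau B l.+2 k.
Proof.
(* The extra term of the longer convolution contains [tau l.+1 0] = 0. *)
rewrite /bern_tau (big_ord_recr k.+1) /= subnn tau_small // mulr0 addr0.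
rewrite mulr_sumr -big_split; apply: eq_bigr => i _ /=.
by rewrite tau_rec subSn -1?ltnS //; ring.
Qed.

Lemma tau0E (k : nat) : tau 0 k = ((k.+1)`!)%:R^-1.
Proof. by rewrite /tau ffactn0 addn0 mul1r. Qed.

Lemma bern_tau0 (B : nat -> rat) (hB : is_bernoulli B) (k : nat) :
  bern_tau B 0 k = (k == 0)%N%:R.
Proof.
move/is_bernoulliE: hB => H.
rewrite /bern_tau big_ord_recr /= subnn tau0E invr1 mulr1 [egf B k]H.
under eq_bigr => i _ do rewrite tau0E.
by rewrite addrC subrK.
Qed.

Lemma tau1E (k : nat) : tau 1 k = tau 0 k - 2 * tau 0 k.+1.
Proof.
rewrite !tau0E /tau ffactn1 addn1 natr_factS.
move: (k.+1)`! (fact_gt0 k.+1) => f f0.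
by field; rewrite -!natrD ?nat1r !pnatr_eq0 -lt0n f0.
Qed.

(** N_1 = coth(t/2) - 2/t = 1 - 2(1 - beta)/t. *)
Lemma bern_tau1 (B : nat -> rat) (hB : is_bernoulli B) (k : nat) :
  bern_tau B 1 k.+1 = 2 * egf B k.+2.
Proof.
have: bern_tau B 1 k.+1 =
    bern_tau B 0 k.+1 - 2 * (bern_tau B 0 k.+2 - egf B k.+2).
  rewrite /bern_tau (big_ord_recr k.+2) /= subnn tau0E invr1 mulr1 addrK.
  rewrite mulr_sumr -sumrB; apply: eq_bigr => i _.
  by rewrite tau1E [(k.+2 - i)%N]subSn -1?ltnS //; ring.
by rewrite !(bern_tau0 hB) /= => ->; ring.
Qed.

Lemma bern_tau_small (B : nat -> rat) (l k : nat) :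
  (k < l)%N -> bern_tau B l k = 0.
Proof.
move=> lt_kl; apply: big1 => i _.
by rewrite tau_small ?mulr0 // (leq_ltn_trans (leq_subr _ _)).
Qed.

Lemma bern_tau_diag (B : nat -> rat) (hB : is_bernoulli B) (l : nat) :
  bern_tau B l l != 0.
Proof.
rewrite /bern_tau big_ord_recl big1 => [|i _].
  have [B0 _ _] := is_bernoulli_small hB.
  rewrite addr0 /egf B0 subn0 divr1 mul1r /tau ffactnn.
  by rewrite mulf_neq0 ?invr_eq0 ?fact_neq0.
by rewrite tau_small ?mulr0 //= /bump /=; have := ltn_ord i; lia.
Qed.

(** In the recurrence both terms of degree k vanish by induction, and the factor 2(2l+3) is
    nonzero. *)
Lemma bern_tau_odd (B : nat -> rat) (hB : is_bernoulli B) (l k : nat) :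
  odd (k + l) -> bern_tau B l k = 0.
Proof.
elim: k l => [|k IH] [|l] //= o; first exact: bern_tau_small.
  by rewrite (bern_tau0 hB).
have := bern_tau_rec B l k; rewrite !IH.
- move/eqP; rewrite eq_sym addr0 mulf_eq0 mulf_eq0 !pnatr_eq0 addn3 /=.
  by move/eqP.
- by move: o; rewrite !addnS /= negbK.
- by move: o; rewrite !addnS /= negbK.
Qed.

(** Summation by parts: the summands differ by W(l+1) - W(l), and the boundary hypotheses make W
    vanish at 0 and n. *)
Lemma alternating_wronskian (f g : nat -> rat) (n : nat) :
  f 0 = 0 -> g 0 = 0 -> f n = 0 -> f n.+1 = 0 ->
  \sum_(l < n) (-1) ^+ l * (f l - f l.+2) * g l.+1 =
  \sum_(l < n) (-1) ^+ l * f l.+1 * (g l - g l.+2).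
Proof.
move=> f0 g0 fn fn1; apply/eqP; rewrite -subr_eq0 -sumrB; apply/eqP.
pose W l := (-1) ^+ l * (f l.+1 * g l - f l * g l.+1).
transitivity (W n - W 0); last by rewrite /W f0 g0 fn fn1; ring.
rewrite -(big_mkord xpredT (fun l => (-1) ^+ l * (f l - f l.+2) * g l.+1
  - (-1) ^+ l * f l.+1 * (g l - g l.+2))) -telescope_sumr //.
by apply: eq_bigr => l _; rewrite /W exprS; ring.
Qed.

(** Induction on i: the Wronskian identity moves one degree from the second factor to the first. The
    cut-off n is harmless because [t^(i+1)]N_(l+1) = 0 for l > i. *)
Lemma egf_bernoulli_hankel (B : nat -> rat) (hB : is_bernoulli B)
    (n i j : nat) :
  (i < n)%N ->
  egf B (i + j).+2 =
  \sum_(l < n) (-1) ^+ l * (2 * l + 3)%:R *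
    bern_tau B l.+1 i.+1 * bern_tau B l.+1 j.+1.
Proof.
have half (l k : nat) :
    (2 * l + 3)%:R * bern_tau B l.+1 k.+1 =
    (bern_tau B l k - bern_tau B l.+2 k) / 2.
  by have -> := bern_tau_rec B l k; field.
elim: i j => [|i IH] j lt_in.
  (* Only l = 0 survives, and 3 [t^1]N_1 = 1/2 cancels the 2 in [bern_tau1]. *)
  case: n lt_in => // n _; rewrite big_ord_recl big1 => [|l _].
    have [_ _ B2] := is_bernoulli_small hB.
    have e2 : egf B 2 = 12^-1 by rewrite /egf B2.
    by rewrite !(bern_tau1 hB) e2 /= !add0n; field.
  by rewrite [bern_tau B _ 1]bern_tau_small ?mulr0 ?mul0r.
rewrite addSnnS IH ?(ltnW lt_in) //.
transitivity ((\sum_(l < n) (-1) ^+ l * bern_tau B l.+1 i.+1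
    * (bern_tau B l j.+1 - bern_tau B l.+2 j.+1)) / 2).
  rewrite mulr_suml; apply: eq_bigr => l _.
  by rewrite -2!mulrA [X in _ * X]mulrCA half; ring.
rewrite -(@alternating_wronskian ((bern_tau B)^~ i.+1)
  ((bern_tau B)^~ j.+1)) ?(bern_tau0 hB) //.
- rewrite mulr_suml; apply: eq_bigr => l _.
  by rewrite -[_ * bern_tau B l.+1 i.+2]mulrA half; ring.
- exact: bern_tau_small.
- by rewrite bern_tau_small // ltnW.
Qed.

(** Write (i+j+1)! = i! (j+1)! C(i+j+1, i), expand by Vandermonde, and use C(i+1, i-r) = (i+1) C(i,
    r) / (r+1). *)
Lemma fact_hankel (n i j : nat) : (i < n)%N ->
  ((i + j).+1`!)%:R = \sum_(r < n)
    (r.+1)%:R^-1 * ((i.+1`!)%:R * 'C(i, r)%:R) * ((j.+1`!)%:R * 'C(j, r)%:R)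
  :> rat.
Proof.
move=> lt_in.
have -> : ((i + j).+1`!)%:R =
    (i`!)%:R * (j.+1`!)%:R * ('C(i.+1 + j, i))%:R :> rat.
  have le_i : (i <= i.+1 + j)%N by rewrite addSn leqW ?leq_addr.
  by rewrite -!natrM -addSn -(bin_fact le_i) addSnnS addKn mulnC.
rewrite -binomial.Vandermonde (reindex_inj rev_ord_inj) /=.
rewrite (big_ord_widen _ (fun r =>
  'C(i.+1, i - r) * 'C(j, i - (i - r)))%N lt_in) big_mkcond /=.
rewrite natr_sum mulr_sumr (natr_factS i); apply: eq_bigr => r _.
rewrite ltnS; case: leqP => [le_ri|lt_ir]; last first.
  by rewrite (bin_small lt_ir) !(mulr0, mul0r).
rewrite subKn // -subSS bin_sub //.
have E : (i.+1)%:R * ('C(i, r))%:R = (r.+1)%:R * ('C(i.+1, r.+1))%:R :> rat.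
  by rewrite -!natrM (mul_bin_diag i.+1).
have r0 : (r.+1)%:R != 0 :> rat by rewrite pnatr_eq0.
rewrite natrM (_ : ('C(i.+1, r.+1))%:R = (i.+1)%:R * ('C(i, r))%:R / (r.+1)%:R).
  by ring.
by rewrite E mulrC mulKf.
Qed.

Theorem proposition15 (B : nat -> rat) (hB : is_bernoulli B) (n : nat) :
  hankel_det n (fun k => mu B k.+1)
    = \det (\matrix_(i < n.+1, j < n.+1) mu B (i + j + 1)%N)
  /\ \det (\matrix_(i < n.+1, j < n.+1) mu B (i + j + 1)%N) <> 0.
Proof.
split.
  by congr (\det _); apply/matrixP => i j; rewrite !mxE addn1.
apply/eqP/det0P => -[v v0 vM].
(* The vectors [a r l] are the rank-one factors of the Hadamard product; [S r l] pairs the kernel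
   vector [v] with them. *)
pose a (r l i : nat) : rat :=
  ((i.+1`!)%:R * 'C(i, r)%:R) * bern_tau B l.+1 i.+1.
pose S r l := \sum_(i < n.+1) v 0 i * a r l i.
have muE (i j : 'I_n.+1) : (-1) ^+ i * mu B (i + j + 1)%N =
    \sum_(r < n.+1) \sum_(l < n.+1)
      ((2 * l + 3)%:R / (r.+1)%:R) * (a r l i * a r l j).
  have -> : mu B (i + j + 1)%N = ((i + j).+1`!)%:R * egf B (i + j).+2.
    rewrite /mu /egf addn1 (natr_factS (i + j).+1).
    move: ((i + j).+1)`! (fact_gt0 (i + j).+1) => f f0.
    by field; rewrite -!natrD ?nat1r !pnatr_eq0 -lt0n f0.
  rewrite (egf_bernoulli_hankel hB _ (ltn_ord i)).
  rewrite (fact_hankel _ (ltn_ord i)) mulrCA mulr_suml.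
  apply: eq_bigr => r _; rewrite !mulr_sumr; apply: eq_bigr => l _.
  (* For i + l odd both sides vanish; otherwise (-1)^l = (-1)^i and the two signs multiply to 1. *)
  have [o|ne] := boolP (odd (i + l)).
    have z : bern_tau B l.+1 i.+1 = 0.
      by apply: bern_tau_odd => //; rewrite addSnnS !addnS /= negbK.
    by rewrite /a z !(mulr0, mul0r).
  have -> : (-1) ^+ l = (-1) ^+ i :> rat.
    by rewrite -signr_odd -[RHS]signr_odd; move: ne;
      rewrite oddD; do 2!case: odd.
  move: ((-1) ^+ i) (sqrr_sign rat i) => e ee.
  by rewrite /a -[RHS]mul1r -ee; ring.
have S0 : \sum_(r < n.+1) \sum_(l < n.+1)
    ((2 * l + 3)%:R / (r.+1)%:R) * S r l ^+ 2 = 0.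
  (* The weighted sum of squares is v M D v^T, with M the Hankel matrix and D = diag((-1)^j); it
     vanishes since v M = 0. *)
  transitivity (\sum_(j < n.+1)
      (v *m (\matrix_(i < n.+1, j < n.+1) mu B (i + j + 1)%N)) 0 j
      * ((-1) ^+ j * v 0 j)); last first.
    by rewrite vM big1 // => j _; rewrite mxE mul0r.
  transitivity (\sum_(j < n.+1) \sum_(i < n.+1) \sum_(r < n.+1)
     \sum_(l < n.+1) ((2 * l + 3)%:R / (r.+1)%:R)
       * ((v 0 j * a r l j) * (v 0 i * a r l i))); last first.
    apply: eq_bigr => j _; rewrite mxE mulr_suml; apply: eq_bigr => i _.
    rewrite mxE.
    have -> : v 0 i * mu B (i + j + 1)%N * ((-1) ^+ j * v 0 j) =
        v 0 j * v 0 i * ((-1) ^+ j * mu B (j + i + 1)%N).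
      by rewrite (addnC j); ring.
    rewrite muE mulr_sumr; apply: eq_bigr => r _.
    by rewrite mulr_sumr; apply: eq_bigr => l _; ring.
  symmetry; under eq_bigr => j _ do rewrite exchange_big.
  rewrite exchange_big; apply: eq_bigr => r _.
  under eq_bigr => j _ do rewrite exchange_big.
  rewrite exchange_big; apply: eq_bigr => l _.
  rewrite expr2 mulr_suml mulr_sumr; apply: eq_bigr => j _.
  by rewrite !mulr_sumr.
(* Each nonnegative term vanishes. The choice r = 0 matters: C(i, 0) = 1 keeps the diagonal below
   nonzero. *)
have S0l (l : 'I_n.+1) : S 0 l = 0.
  have ge0 (r l' : 'I_n.+1) :
      0 <= (2 * l' + 3)%:R / (r.+1)%:R * S r l' ^+ 2.
    by rewrite mulr_ge0 ?sqr_ge0 // divr_ge0 ?ler0n.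
  have /(_ ord0 isT)/psumr_eq0P := psumr_eq0P (fun r _ =>
    sumr_ge0 _ (fun l' _ => ge0 r l')) S0.
  move/(_ (fun l' _ => ge0 _ l') l isT)/eqP.
  by rewrite mulf_eq0 sqrf_eq0 divr1 pnatr_eq0 addn3 => /eqP.
(* This matrix is triangular, as N_(l+1) starts in degree l+1, hence invertible, which forces v =
   0. *)
have : v *m (\matrix_(i < n.+1, l < n.+1) a 0 l i) = 0.
  by apply/rowP => l; rewrite !mxE -[RHS](S0l l);
    apply: eq_bigr => i _; rewrite mxE.
move/(congr1 (mulmx^~ (invmx (\matrix_(i < n.+1, l < n.+1) a 0 l i)))).
rewrite mulmxK ?mul0mx; first by move=> v00; rewrite v00 eqxx in v0.
rewrite unitmxE unitfE det_trig.
  apply/prodf_neq0 => i _; rewrite mxE /a bin0 mulr1.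
  by rewrite mulf_neq0 ?fact_neq0 ?bern_tau_diag.
apply/is_trig_mxP => i l lt_il.
by rewrite mxE /a (@bern_tau_small _ l.+1) ?mulr0.
Qed.
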